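(* There is an absolute constant $c>0$ such that the following holds. Let $r\ge 1$ be an integer and let $A,B$ be finite nonempty subsets of $\mathbb{R}$, where $A$ has distinct consecutive $r$--differences. Then $$|A+B| \ge c\, e^{-r(\log 2+1)}\,|A|\,|B|^{1/(r+1)}.$$ Moreover, this inequality is sharp up to the constant: for each $r\ge1$ there is a constant $C_r>0$ such that for arbitrarily large values of $|B|$ there exist finite sets $A,B\subset\mathbb{Z}$, with $A$ having distinct consecutive $r$--differences, satisfying $|A+B|\le C_r\,|A|\,|B|^{1/(r+1)}$.
   Context: For finite $A,B$, $A+B=\{a+b: a\in A, b\in B\}$. Write a finite set $A\subset\mathbb{R}$ as $A=\{a_1<a_2<\dots<a_k\}$. For an integer $r\ge1$, $A$ has distinct consecutive $r$--differences if the $r$-tuples $(a_{i+1}-a_i,\dots,a_{i+r}-a_{i+r-1})$, $1\le i\le k-r$, are pairwise distinct. *)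

(* Defs.v *)
From mathcomp Require Import all_boot all_order all_algebra.
From mathcomp Require Import finmap.

Set Implicit Arguments.
Unset Strict Implicit.
Unset Printing Implicit Defensive.

Import Order.TTheory GRing.Theory Num.Theory.

Local Open Scope fset_scope.
Local Open Scope ring_scope.

Definition sumset (T : realDomainType) (A B : {fset T}) : {fset T} :=
  [fset a + b | a in A, b in B].

Definition increasing_enum (T : realDomainType) (A : {fset T}) : seq T :=
  sort <=%R (enum_fset A).

(* Indices start at 0, so the window start i ranges over 0 <= i < k - r. The   *)
(* subtraction is truncated: if k <= r there are no windows and the condition  *)
(* holds vacuously.                                                            *)
Definition distinct_consecutive_differences (T : realDomainType) (r : nat)
    (A : {fset T}) : bool :=
  let a := increasing_enum A in
  uniq (mkseq (fun i => mkseq (fun l => a`_(i + l).+1 - a`_(i + l)) r)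
              (#|` A| - r)).

(* Main.v *)
(* Lower bound. List the points of [A + B] in increasing order, and let       *)
(* s = |A + B| and n = |A| - r. For fixed b, the lengths (in positions of      *)
(* A + B) of the n windows of r + 1 consecutive points of A + b sum to at most *)
(* r s, so at least half of the pairs (window, b) have length below            *)
(* t = O(r s / n). A window of A + b is determined by its positions, because   *)
(* its differences are distinct from those of all other windows of A; hence    *)
(* n |B| <= 2 s t^r, that is n^(r+1) |B| <= (4 r s)^(r+1).                      *)
(*                                                                             *)
(* Sharpness. A walk with r m^r steps of size at most r m and distinct         *)
(* r-windows has diameter O(m^(r+1)); take B to be an interval of length       *)
(* m^(r+1).                                                                    *)

Require Import Defs.
From mathcomp Require Import all_boot all_order all_algebra.
From mathcomp Require Import finmap.
From mathcomp Require Import zify lra.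
From mathcomp Require Import reals sequences exp.

Set Implicit Arguments.
Unset Strict Implicit.
Unset Printing Implicit Defensive.

Import Order.TTheory GRing.Theory Num.Theory.

Local Open Scope fset_scope.
Local Open Scope ring_scope.

(** The count behind the lower bound is an encoding. A pair (window of [A], [b]) is sent to the
    first point of the shifted window and the offsets of its other [r] points in the ordering of
    [A + B]. This is injective on short pairs ([short_windows_le]), and most pairs are short because
    gaps telescope ([sum_gap_le]); [windows_bound] combines the two. Taking roots and replacing
    [|A| - r] by [|A|] costs a factor [4 r (r + 1)], which [sqr_le_expR] absorbs, so [c = 1/4]
    works.

    For sharpness, write the base [m] digits of 0, 1, 2, ... one number after another, [r] digits
    each, and use them as steps of a walk. By [letter_windows_inj] no [r]-window repeats, while the
    steps stay bounded by [r m]. *)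

Section IncreasingEnum.
Variables (T : realDomainType) (A : {fset T}).

Lemma size_increasing_enum : size (increasing_enum A) = #|` A|.
Proof. by rewrite size_sort. Qed.

Lemma mem_increasing_enum : increasing_enum A =i A.
Proof. by move=> x; rewrite mem_sort. Qed.

Lemma increasing_enum_lt_sorted : sorted <%R (increasing_enum A).
Proof. by rewrite sort_lt_sorted fset_uniq. Qed.

Lemma increasing_enum_nth_in (i : nat) :
  (i < #|` A|)%N -> (increasing_enum A)`_i \in A.
Proof.
by move=> ltiA; rewrite -mem_increasing_enum mem_nth ?size_increasing_enum.
Qed.

Lemma increasing_enum_nth_le (i j : nat) :
  (i <= j < #|` A|)%N -> (increasing_enum A)`_i <= (increasing_enum A)`_j.
Proof.
case/andP=> leij ltjA; rewrite (lt_sorted_leq_nth 0) //.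
- exact: increasing_enum_lt_sorted.
- by rewrite inE size_increasing_enum (leq_ltn_trans leij).
- by rewrite inE size_increasing_enum.
Qed.

End IncreasingEnum.

(** * Positions of points in a finite set *)

Section Rank.
Variables (T : realDomainType) (S : {fset T}).

Definition rank (x : T) : nat := #|[set s : S | val s < x]|.

Lemma rank_le_card (x : T) : (rank x <= #|` S|)%N.
Proof. by rewrite cardfE max_card. Qed.

Lemma rank_homo : {homo rank : x y / x <= y >-> (x <= y)%N}.
Proof.
move=> x y lexy; apply/subset_leq_card/subsetP => s.
by rewrite !inE => /lt_le_trans; apply.
Qed.

Lemma rank_lt (x y : T) : x \in S -> x < y -> (rank x < rank y)%N.
Proof.
move=> Sx ltxy; apply/proper_card/properP; split.
  by apply/subsetP=> s; rewrite !inE => /lt_trans; apply.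
by exists [` Sx]; rewrite !inE //= ltxx.
Qed.

Lemma rank_inj : {in S &, injective rank}.
Proof.
move=> x y Sx Sy eqr; case: (ltgtP x y) => // [/(rank_lt Sx)|/(rank_lt Sy)];
  by rewrite eqr ltnn.
Qed.

End Rank.

(** Telescoping: the sums of [h (i + r)] and of [h i] differ only in [r] terms at each end, so only
    the last [r] values, each at most [s], matter. *)
Lemma sum_shift_sub_le (h : nat -> nat) (n r s : nat) :
    (forall i, (i < n)%N -> (h i <= h (i + r)%N)%N) ->
    (forall i, (h i <= s)%N) ->
  (\sum_(i < n) (h (i + r)%N - h i) <= r * s)%N.
Proof.
move=> hmono hle.
have eqs : (\sum_(i < r) h i + \sum_(i < n) h (i + r)
           = \sum_(i < n) h i + \sum_(i < r) h (n + i))%N.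
  have split p q : (\sum_(i < p + q) h i = \sum_(i < p) h i + \sum_(i < q) h (p + i))%N.
    by rewrite big_split_ord.
  by rewrite -split (addnC n) split; congr (_ + _)%N; apply: eq_bigr => i _; rewrite addnC.
have eqd : (\sum_(i < n) (h (i + r) - h i) + \sum_(i < n) h i
           = \sum_(i < n) h (i + r))%N.
  by rewrite -big_split; apply: eq_bigr => i _ /=; rewrite subnK ?hmono.
have: (\sum_(i < r) h (n + i) <= r * s)%N.
  by rewrite -[r in (r * _)%N]card_ord -sum_nat_const leq_sum.
by lia.
Qed.

Lemma sumsetC (T : realDomainType) (A B : {fset T}) : sumset A B = sumset B A.
Proof.
by apply/fsetP => x; apply/imfset2P/imfset2P => -[a aA [b bB ->]];
   exists b => //; exists a => //; rewrite addrC.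
Qed.

Lemma card_sumset_ge (T : realDomainType) (A B : {fset T}) :
  B != fset0 -> (#|` A| <= #|` sumset A B|)%N.
Proof.
case/fset0Pn=> b bB; rewrite -(card_imfset imfset_key (mem A) (@addIr _ b)).
apply/fsubset_leq_card/fsubsetP => x /imfsetP[a /= aA ->].
exact: in_imfset2.
Qed.

(** * Counting short windows in the sumset *)

Section WindowCount.
Variables (T : realDomainType) (r : nat) (A B : {fset T}).
Hypothesis ltrA : (r < #|` A|)%N.
Hypothesis uniqA : distinct_consecutive_differences r A.

Let a := increasing_enum A.
Let S := sumset A B.
Let n := (#|` A| - r)%N.

Let pos (b : T) (i : nat) : nat := rank S (a`_i + b).

Let mem_sum (i : nat) (b : B) : (i < #|` A|)%N -> a`_i + val b \in S.
Proof. by move=> ltiA; apply/in_imfset2/fsvalP/increasing_enum_nth_in. Qed.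

Let pos_mono (b : T) (i j : nat) :
  (i <= j < #|` A|)%N -> (pos b i <= pos b j)%N.
Proof. by move=> lij; rewrite rank_homo // lerD2r increasing_enum_nth_le. Qed.

Let pos_le (b : T) (i : nat) : (pos b i <= #|` S|)%N.
Proof. exact: rank_le_card. Qed.

Let gap (p : 'I_n * B) : nat := (pos (val p.2) (p.1 + r) - pos (val p.2) p.1)%N.

Lemma windows_in_A (i : 'I_n) (l : nat) : (l <= r)%N -> (i + l < #|` A|)%N.
Proof. by have := ltn_ord i; rewrite /n => + lelr; lia. Qed.

(* A window of [A + b] is recovered from the positions of its points in     *)
(* [A + B]: they determine its difference tuple, hence [i], and then [b]. *)
Lemma short_windows_le (t : nat) :
  (#|[set p | gap p < t]| <= #|` S| * t ^ r)%N.
Proof.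
case: t => [|t]; first by rewrite [X in (X <= _)%N]eq_card0 // => p; rewrite !inE.
pose mem0 (p : 'I_n * B) :=
  [` mem_sum p.2 (leq_trans (ltn_ord p.1) (leq_subr r #|` A|))].
(* On short pairs [inord] loses nothing, since each offset is at most the gap. *)
pose f (p : 'I_n * B) : S * {ffun 'I_r -> 'I_t.+1} :=
  (mem0 p,
   [ffun l : 'I_r => inord (pos (val p.2) (p.1 + l.+1) - pos (val p.2) p.1)]).
suff finj : {in [set p | gap p < t.+1]%N &, injective f}.
  have := leq_card_in f _ finj.
  by rewrite card_prod card_ffun !card_ord -cardfE.
move=> p q; rewrite !inE => gp gq /pair_equal_spec [/(congr1 val) /= eq0 /ffunP eqf].
have gap_small (u : 'I_n * B) (l : nat) : (gap u < t.+1)%N -> (l <= r)%N ->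
    (pos (val u.2) (u.1 + l) - pos (val u.2) u.1 < t.+1)%N.
  move=> gu lelr; apply: leq_ltn_trans gu; apply: leq_sub2r.
  by apply: pos_mono; rewrite leq_add2l lelr windows_in_A.
have eql (l : nat) : (l <= r)%N ->
    a`_(p.1 + l) + val p.2 = a`_(q.1 + l) + val q.2.
  case: l => [|l] lelr; first by rewrite !addn0.
  apply: (@rank_inj _ S); rewrite ?mem_sum ?windows_in_A //.
  have := eqf (Ordinal lelr); rewrite !ffunE => /(congr1 val) /=.
  rewrite (inordK (gap_small p _ gp lelr)) (inordK (gap_small q _ gq lelr)) => eqg.
  have le0 (u : 'I_n * B) : (pos (val u.2) u.1 <= pos (val u.2) (u.1 + l.+1))%N.
    by apply: pos_mono; rewrite leq_addr windows_in_A.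
  have eqp : pos (val p.2) p.1 = pos (val q.2) q.1 by rewrite /pos eq0.
  change (pos (val p.2) (p.1 + l.+1)%N = pos (val q.2) (q.1 + l.+1)%N).
  by rewrite -(subnK (le0 p)) eqg eqp subnK.
have eq1 : p.1 = q.1.
  apply/val_inj; apply: (mkseq_uniqP _ _ uniqA); rewrite ?inE ?ltn_ord //=.
  apply/eq_in_map => l; rewrite mem_iota /= add0n => ltlr.
  have diffE (u : 'I_n * B) : a`_(u.1 + l).+1 - a`_(u.1 + l) =
      (a`_(u.1 + l.+1) + val u.2) - (a`_(u.1 + l) + val u.2).
    by rewrite addnS opprD addrACA subrr addr0.
  by rewrite (diffE p) (diffE q) (eql _ ltlr) (eql _ (ltnW ltlr)).
case: p q eq1 eq0 {gp gq eqf eql} => [i b] [j c] /= <- /addrI /val_inj <- //.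
Qed.

Lemma sum_gap_le : (\sum_p gap p <= #|` B| * (r * #|` S|))%N.
Proof.
rewrite -(pair_bigA _ (fun i b => gap (i, b))) exchange_big /=.
rewrite cardfE -sum_nat_const; apply: leq_sum => b _.
apply: (@sum_shift_sub_le (pos (val b))) => // i ltin.
by apply: pos_mono; rewrite leq_addr (windows_in_A (Ordinal ltin)).
Qed.

Lemma windows_bound :
  (0 < r)%N -> (n ^ r.+1 * #|` B| <= (4 * r * #|` S|) ^ r.+1)%N.
Proof.
move=> r_gt0; have [->|B0] := eqVneq B fset0; first by rewrite cardfs0 muln0.
have n_gt0 : (0 < n)%N by rewrite subn_gt0.
have leAS : (#|` A| <= #|` S|)%N := card_sumset_ge A B0.
(* With [t] just above [2 r s / n], Markov's inequality leaves at most half of the pairs with gap at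
   least [t]. Rounding up costs at most [n <= s], whence [t n <= 4 r s]. *)
set s := #|` S| in leAS *; set t := ((2 * r * s) %/ n).+1.
have lt_tn : (2 * r * s < t * n)%N by exact: ltn_ceil.
have le_tn : (t * n <= 4 * r * s)%N.
  have := leq_divM (2 * r * s) n.
  by have : (n <= s)%N; rewrite /t /n; nia.
pose G := [set p | gap p < t]%N.
have bad_le : (#|~: G| * t <= #|` B| * (r * s))%N.
  apply: leq_trans sum_gap_le; rewrite -sum_nat_const [leqRHS](bigID (mem (~: G))) /=.
  apply: leq_trans (leq_addr _ _); apply: leq_sum => p.
  by rewrite !inE -leqNgt.
have cardG : (#|G| + #|~: G| = n * #|` B|)%N.
  by rewrite cardsC card_prod card_ord -cardfE.
have half : (n * #|` B| <= 2 * #|G|)%N.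
  suff : (2 * #|~: G| <= n * #|` B|)%N by lia.
  by rewrite -(leq_pmul2r (ltn0Sn _ : 0 < t)%N); nia.
have := short_windows_le t; rewrite -/G -/s => leG.
rewrite expnSr -mulnA; apply: (@leq_trans (2 * s * (t * n) ^ r)%N).
  rewrite expnMn; have := leq_mul (leqnn (n ^ r)%N) (leq_trans half (leq_mul (leqnn 2) leG)).
  by lia.
apply: (@leq_trans (2 * s * (4 * r * s) ^ r)%N).
  by rewrite leq_mul // leq_exp2r.
by rewrite expnS leq_mul2r; apply/orP; right; nia.
Qed.

End WindowCount.

(** * A slow integer walk with distinct windows *)

Lemma mem_fset_mkseqP (T : choiceType) (f : nat -> T) (k : nat) (x : T) :
  reflect (exists2 i, (i < k)%N & x = f i) (x \in [fset y in mkseq f k]).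
Proof.
rewrite in_fset /=; apply: (iffP mapP) => -[i].
  by rewrite mem_iota => ltik ->; exists i.
by move=> ltik ->; exists i; rewrite ?mem_iota.
Qed.

Lemma increasing_enum_mkseq (T : realDomainType) (f : nat -> T) (k : nat) :
    {homo f : i j / (i < j)%N >-> i < j} ->
  increasing_enum [fset x in mkseq f k] = mkseq f k.
Proof.
move=> fmono; have sf : sorted <%R (mkseq f k).
  by rewrite sorted_map; apply: sub_sorted (iota_ltn_sorted 0 k) => i j /fmono.
apply: lt_sorted_eq => //.
  by rewrite sort_lt_sorted fset_uniq.
by move=> x; rewrite mem_sort !inE.
Qed.

Lemma eqn_mod_exp_digits (m j x y : nat) :
    (forall s, (s < j)%N -> (x %/ m ^ s) %% m = (y %/ m ^ s) %% m)%N ->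
  (x = y %[mod m ^ j])%N.
Proof.
elim: j => [|j IHj] eqd; first by rewrite expn0 !modn1.
have modS (z : nat) :
    (z %% m ^ j.+1 = (z %/ m ^ j) %% m * m ^ j + z %% m ^ j)%N.
  case: (posnP m) => [->|m0]; last first.
    rewrite {1}(divn_eq z (m ^ j)) {1}(divn_eq (z %/ m ^ j) m) mulnDl -mulnA.
    rewrite -expnS -addnA modnMDl modn_small //.
    have lm := ltn_pmod (z %/ m ^ j) m0.
    have mj0 : (0 < m ^ j)%N by rewrite expn_gt0 m0.
    apply: (@leq_trans ((z %/ m ^ j %% m).+1 * m ^ j)%N).
      by rewrite mulSn addnC ltn_add2r ltn_pmod.
    by rewrite expnS leq_pmul2r.
  (* The remaining case is [m = 0], where [z %% 0 = z]. *)
  case: j {IHj eqd} => [|j]; last by rewrite !exp0n // !modn0 muln0.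
  by rewrite exp0n // expn0 modn1 divn1 !modn0 muln1 addn0.
by rewrite !modS eqd // IHj // => s ltsj; apply/eqd/ltnW.
Qed.

Section DigitSequence.
Variables (r m : nat).
Hypothesis (r_gt0 : (0 < r)%N) (m_gt0 : (0 < m)%N).

(* Position q r + j of the sequence shows the j-th base m digit of q, written *)
(* in a private alphabet so that a letter also determines j.                  *)
Definition letter (p : nat) : nat :=
  ((p %% r) * m + ((p %/ r) %/ m ^ (p %% r)) %% m).+1.

Lemma letter_le (p : nat) : (letter p <= r * m)%N.
Proof.
have lp := ltn_pmod p r_gt0; have ld := ltn_pmod (p %/ r %/ m ^ (p %% r)) m_gt0.
rewrite /letter; apply: (@leq_trans ((p %% r).+1 * m)%N).
  by rewrite mulSn addnC -addSn leq_add2r.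
by rewrite leq_mul2r lp orbT.
Qed.

Lemma letter_inj (p q : nat) : letter p = letter q ->
  (p %% r = q %% r /\
   (p %/ r %/ m ^ (p %% r)) %% m = (q %/ r %/ m ^ (q %% r)) %% m)%N.
Proof.
move=> [] eqpq; have := congr1 (modn^~ m) eqpq; rewrite !modnMDl !modn_mod => eqd.
split=> //; apply/eqP; rewrite -(eqn_pmul2r m_gt0).
by move/eqP: eqpq; rewrite eqd eqn_add2r.
Qed.

(* With [i = q r + j], the window starting at [i] shows the digits [>= j] of *)
(* [q] and the digits [< j] of [q + 1]; the latter determine [q mod m ^ j].  *)
Lemma letter_windows_inj (i i' : nat) :
    (i < r * m ^ r)%N -> (i' < r * m ^ r)%N ->
    (forall l, (l < r)%N -> letter (i + l) = letter (i' + l)) ->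
  i = i'.
Proof.
move=> lti lti' eqw.
have /letter_inj[] := eqw 0%N r_gt0; rewrite !addn0 => eqj _.
set j := (i %% r)%N in eqj; have ltjr : (j < r)%N by exact: ltn_pmod.
set q := (i %/ r)%N; set q' := (i' %/ r)%N.
have Ei : i = (q * r + j)%N by exact: divn_eq.
have Ei' : i' = (q' * r + j)%N by rewrite eqj; exact: divn_eq.
have lo s : (s < j)%N -> ((q.+1 %/ m ^ s) %% m = (q'.+1 %/ m ^ s) %% m)%N.
  move=> ltsj; have ltsr := ltn_trans ltsj ltjr.
  have /letter_inj[_] := eqw (r - j + s)%N ltac:(lia).
  have -> : (i + (r - j + s) = q.+1 * r + s)%N by rewrite mulSn; lia.
  have -> : (i' + (r - j + s) = q'.+1 * r + s)%N by rewrite mulSn; lia.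
  by rewrite !modnMDl !divnMDl // !(modn_small ltsr) !(divn_small ltsr) !addn0.
have hi s : (j <= s < r)%N -> ((q %/ m ^ s) %% m = (q' %/ m ^ s) %% m)%N.
  case/andP=> lejs ltsr; have /letter_inj[_] := eqw (s - j)%N ltac:(lia).
  have -> : (i + (s - j) = q * r + s)%N by lia.
  have -> : (i' + (s - j) = q' * r + s)%N by lia.
  by rewrite !modnMDl !divnMDl // !(modn_small ltsr) !(divn_small ltsr) !addn0.
(* Congruence of [q + 1] and [q' + 1] modulo [m ^ j] cancels to [q] and [q'], which recovers the low
   digits not shown in the window. *)
have eqmod : (q = q' %[mod m ^ j])%N.
  have /eqP := eqn_mod_exp_digits lo.
  by rewrite -(addn1 q) -(addn1 q') eqn_modDr => /eqP.
have low s : (s < j)%N -> ((q %/ m ^ s) %% m = (q' %/ m ^ s) %% m)%N.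
  move=> ltsj; have dg z : ((z %/ m ^ s) %% m = (z %% m ^ j) %/ m ^ s %% m)%N.
    have -> : (m ^ j = m ^ (j - s.+1) * m * m ^ s)%N.
      by rewrite -expnSr -expnD; congr (_ ^ _)%N; lia.
    rewrite {1}(divn_eq z (m ^ (j - s.+1) * m * m ^ s)) mulnA divnMDl ?expn_gt0 ?m_gt0 //.
    by rewrite mulnA modnMDl.
  by rewrite dg eqmod -dg.
have : (q = q' %[mod m ^ r])%N.
  apply: eqn_mod_exp_digits => s ltsr.
  by case: (ltnP s j) => [/low //|lejs]; apply: hi; rewrite lejs.
have ltq z : (z < r * m ^ r)%N -> (z %/ r < m ^ r)%N.
  by rewrite ltn_divLR // mulnC.
by rewrite !modn_small ?ltq // => eqq; rewrite Ei Ei' eqq.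
Qed.

Definition walk (k : nat) : nat := \sum_(p < k) letter p.

Lemma walkS (k : nat) : walk k.+1 = (walk k + letter k)%N.
Proof. exact: big_ord_recr. Qed.

(** Steps are positive because [letter] is a successor. *)
Lemma walk_homo : {homo walk : i j / (i < j)%N}.
Proof.
by apply: homo_ltn => [? ? ?|i]; [exact: ltn_trans | rewrite walkS /letter addnS ltnS leq_addr].
Qed.

Lemma walk_le (k : nat) : (walk k <= k * (r * m))%N.
Proof.
rewrite -[k in (_ <= k * _)%N]card_ord -sum_nat_const.
by apply: leq_sum => p _; exact: letter_le.
Qed.

Definition walk_set : {fset int} :=
  [fset x in mkseq (fun i => (walk i)%:Z) (r * m ^ r).+1].

Lemma walkZ_homo : {homo (fun i => (walk i)%:Z) : i j / (i < j)%N >-> i < j}.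
Proof. by move=> i j /walk_homo; rewrite ltz_nat. Qed.

Lemma card_walk_set : #|` walk_set| = (r * m ^ r).+1.
Proof.
by rewrite -size_increasing_enum (increasing_enum_mkseq _ walkZ_homo) size_mkseq.
Qed.

Lemma walk_set_distinct : distinct_consecutive_differences r walk_set.
Proof.
rewrite /distinct_consecutive_differences card_walk_set.
rewrite (increasing_enum_mkseq _ walkZ_homo).
apply/mkseq_uniqP => i i'; rewrite !inE => lti lti' eqw.
apply: letter_windows_inj => [||l ltlr]; try by lia.
have := congr1 (fun w => w`_l) eqw; rewrite !nth_mkseq //; try by lia.
rewrite !walkS; lia.
Qed.

Definition interval_set (M : nat) : {fset int} := [fset x in mkseq Posz M].

Lemma card_interval_set (M : nat) : #|` interval_set M| = M.
Proof.
by rewrite -size_increasing_enum increasing_enum_mkseq ?size_mkseq // => i j.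
Qed.

(** Both sets lie in intervals starting at 0, so the sumset lies in an interval of the added
    lengths. *)
Lemma card_sumset_walk_le (M : nat) :
  (#|` sumset walk_set (interval_set M)| <= r * m ^ r * (r * m) + M)%N.
Proof.
rewrite -(card_interval_set (_ + M)%N); apply/fsubset_leq_card/fsubsetP => x.
case/imfset2P=> _ /mem_fset_mkseqP[i lti ->] [_ /mem_fset_mkseqP[b ltb ->] ->].
apply/mem_fset_mkseqP; exists (walk i + b)%N; last by rewrite PoszD.
have := walk_le i.
have : (i * (r * m) <= r * m ^ r * (r * m))%N by rewrite leq_mul2r; lia.
lia.
Qed.

End DigitSequence.

(** * Roots, constants and conclusion *)

Lemma mul_powR_inv_le (R : realType) (k : nat) (x y b : R) :
    0 <= x -> 0 <= y -> 0 <= b -> x ^+ k.+1 * b <= y ^+ k.+1 ->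
  x * b `^ (k.+1%:R)^-1 <= y.
Proof.
move=> x0 y0 b0 le_xy.
have rootK z : 0 <= z -> (z ^+ k.+1) `^ (k.+1%:R)^-1 = z.
  by move=> z0; rewrite -powR_mulrn // -powRrM mulfV ?pnatr_eq0 // powRr1.
rewrite -[x in x * _]rootK // -powRM ?exprn_ge0 // -[leRHS]rootK //.
by apply: ge0_ler_powR; rewrite ?invr_ge0 ?nnegrE ?mulr_ge0 ?exprn_ge0.
Qed.

(** The right side is [2 ^ r] times [e ^ r], and each factor is at least [r + 1]. *)
Lemma sqr_le_expR (R : realType) (r : nat) :
  (r.+1%:R ^+ 2 : R) <= expR (r%:R * (ln 2 + 1)).
Proof.
rewrite mulrDr mulr1 expRD expRM_natl lnK ?posrE // expr2.
apply: ler_pM => //; first by rewrite -natrX ler_nat ltn_expl.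
by rewrite -natr1 addrC expR_ge1Dx.
Qed.

Lemma card_sumset_lower_bound (R : realType) (r : nat) (A B : {fset R}) :
    (1 <= r)%N -> A != fset0 -> B != fset0 ->
    distinct_consecutive_differences r A ->
  (4^-1 : R) * expR (- (r%:R * (ln 2 + 1))) * #|` A|%:R
    * (#|` B|%:R `^ (r.+1%:R)^-1) <= #|` sumset A B|%:R.
Proof.
move=> r1 A0 B0 dA; set k := #|` A|; set b := #|` B|; set s := #|` _|.
set E := expR (r%:R * (ln 2 + 1) : R); set beta := _ `^ _.
have E0 : 0 < E by exact: expR_gt0.
have rE : r.+1%:R ^+ 2 <= E := sqr_le_expR R r.
have beta0 : 0 <= beta by exact: powR_ge0.
suff : k%:R * beta <= 4 * E * s%:R.
  rewrite expRN -/E => le_kbeta.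
  have -> : 4^-1 * E^-1 * k%:R * beta = (k%:R * beta) / (4 * E).
    by rewrite invfM -[LHS]mulrA mulrC.
  by rewrite ler_pdivrMr ?mulr_gt0 // [leRHS]mulrC.
(* If [|A| <= r] there are no windows to count, but [|A + B| >= |B|] already suffices. *)
have [lekr|ltrk] := leqP k r.
  have beta_le : beta <= s%:R.
    apply: (@le_trans _ _ b%:R).
      apply: ler1_powR; first by rewrite ler1n cardfs_gt0.
      by rewrite invf_le1 ?ltr0n // ler1n.
    by rewrite ler_nat /s sumsetC card_sumset_ge.
  have kE : k%:R <= 4 * E.
    have : (k%:R : R) <= r.+1%:R ^+ 2 by rewrite -natrX ler_nat; nia.
    by lra.
  by apply: ler_pM.
have leN : (k - r)%:R * beta <= (4 * r * s)%:R.
  apply: mul_powR_inv_le => //.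
  by rewrite -!natrX -natrM ler_nat windows_bound.
(* Here [k - r >= 1], so [k = (k - r) + r <= (r + 1) (k - r)]. *)
have lek : (k%:R : R) <= r.+1%:R * (k - r)%:R by rewrite -natrM ler_nat; nia.
apply: le_trans (ler_wpM2r beta0 lek) _; rewrite -[leLHS]mulrA.
apply: le_trans (ler_wpM2l (ler0n _ r.+1) leN) _; rewrite -natrM.
apply: (@le_trans _ _ (4 * r.+1%:R ^+ 2 * s%:R)).
  by rewrite -natrX -!natrM ler_nat; nia.
by rewrite ler_wpM2r // ler_wpM2l.
Qed.

(** The walk contributes [r ^ 2 * m ^ r.+1] and the interval [m ^ r.+1], while [|A|] times the root
    of [|B|] exceeds [r * m ^ r.+1]. *)
Lemma card_sumset_walk_sharp (R : realType) (r m : nat) :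
    (0 < r)%N -> (0 < m)%N ->
  (#|` sumset (walk_set r m) (interval_set (m ^ r.+1))|%:R : R)
    <= (r ^ 2).+1%:R * #|` walk_set r m|%:R
       * (#|` interval_set (m ^ r.+1)|%:R `^ (r.+1%:R)^-1).
Proof.
move=> r0 m0; rewrite card_walk_set // card_interval_set.
have -> : ((m ^ r.+1)%:R `^ (r.+1%:R)^-1 : R) = m%:R.
  by rewrite natrX -powR_mulrn // -powRrM mulfV ?pnatr_eq0 // powRr1.
rewrite -!natrM ler_nat; apply: leq_trans (card_sumset_walk_le r0 m0 _) _.
by rewrite expnSr; nia.
Qed.

Theorem theorem1p1 (R : realType) :
  (exists c : R, 0 < c /\
     forall (r : nat) (A B : {fset R}),
       (1 <= r)%N -> A != fset0 -> B != fset0 ->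
       distinct_consecutive_differences r A ->
       c * expR (- (r%:R * (ln 2 + 1))) * #|` A|%:R
         * (#|` B|%:R `^ (r.+1%:R)^-1)
       <= #|` sumset A B|%:R)
  /\
  (forall r : nat, (1 <= r)%N ->
     exists C : R, 0 < C /\
       forall N : nat, exists A B : {fset int},
         [/\ A != fset0, B != fset0, (N <= #|` B|)%N,
             distinct_consecutive_differences r A
           & #|` sumset A B|%:R
             <= C * #|` A|%:R * (#|` B|%:R `^ (r.+1%:R)^-1)]).
Proof.
split.
  exists 4^-1; split; first by rewrite invr_gt0.
  by move=> r A B; exact: card_sumset_lower_bound.
move=> r r0; exists (r ^ 2).+1%:R; split; first by rewrite ltr0n.
move=> N; exists (walk_set r N.+1), (interval_set (N.+1 ^ r.+1)).
have leN : (N < N.+1 ^ r.+1)%N.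
  by rewrite -[X in (X <= _)%N]expn1 leq_pexp2l.
split; last exact: card_sumset_walk_sharp.
- by rewrite -cardfs_gt0 card_walk_set.
- by rewrite -cardfs_gt0 card_interval_set; exact: leq_trans leN.
- by rewrite card_interval_set ltnW.
- exact: walk_set_distinct.
Qed.
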